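(* Let $t_0 \in \mathbb{R}$, let $g$ be a real function analytic near $t_0$, let $f$ be a real function analytic near $g(t_0)$, and let $h$ be the composition $h(t) = (f\circ g)(t) = f(g(t))$. Denote by $\{G(k)\}_{k=0}^{\infty}$ the differential transformation of $g$ at $t_0$, by $\{F(k)\}_{k=0}^{\infty}$ the differential transformation of $f$ at $g(t_0)$, and by $\{H(k)\}_{k=0}^{\infty}$ the differential transformation of $h$ at $t_0$. Then $H(0) = F(0)$ and $$H(k) = \sum_{l=1}^{k} F(l)\cdot \hat{B}_{k,l}\bigl(G(1),\ldots,G(k-l+1)\bigr) \quad \text{for all integers } k\ge 1,$$ where $\hat{B}_{k,l}$ are the partial ordinary Bell polynomials.
   Context: The differential transformation of a real function $u$ at a point $a\in\mathbb{R}$, where $u$ is analytic in some neighbourhood of $a$, is the sequence $\mathcal{D}\{u(t)\}[a] = \{U(k)[a]\}_{k=0}^{\infty}$ with $$U(k)[a] = \frac{1}{k!}\left[\frac{d^k u(t)}{dt^k}\right]_{t=a}.$$ The base point is omitted from the notation when it is clear. The partial ordinary Bell polynomials $\hat{B}_{k,l}(\hat{x}_1,\ldots,\hat{x}_{k-l+1})$ ($k\ge l\ge 0$ integers) in the infinitely many variables $\hat{x}_1,\hat{x}_2,\ldots$ are defined by the (formal power) series expansion $$\sum_{k\ge l}\hat{B}_{k,l}(\hat{x}_1,\ldots,\hat{x}_{k-l+1})\,t^k = \left(\sum_{m\ge 1}\hat{x}_m t^m\right)^l,\qquad l=0,1,2,\ldots$$ *)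

(* Defs.v *)
From Stdlib Require Import Reals.
From HB Require Import structures.
From mathcomp Require Import all_boot all_order all_algebra finmap.
From mathcomp Require Import boolp zify.
From mathcomp.multinomials Require Import monalg.
From Coquelicot Require Import Coquelicot.

Set Implicit Arguments.
Unset Strict Implicit.
Unset Printing Implicit Defensive.

Local Open Scope R_scope.

(** Analytic functions are modelled by total functions [R -> R]; only their
    values near the relevant point matter. *)

Definition analytic_at (u : R -> R) (a : R) : Prop :=
  exists c : nat -> R,
    locally a (fun t : R => is_pseries c (t - a) (u t)).

Definition analytic_near (u : R -> R) (a : R) : Prop :=
  locally a (fun x : R => analytic_at u x).

Definition DT (u : R -> R) (a : R) (k : nat) : R :=
  Derive_n u k a / INR (Factorial.fact k).

Import GRing.Theory.
Local Open Scope ring_scope.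

(** [R] as a MathComp commutative ring. The instances of the file [Rstruct] are
    not used because they depend on the axiom [epsilon_statement]. *)
HB.instance Definition _ := gen_eqMixin R.
HB.instance Definition _ := gen_choiceMixin R.

Fact RplusA : associative Rplus.
Proof. by move=> x y z; rewrite Rplus_assoc. Qed.

HB.instance Definition _ :=
  GRing.isZmodule.Build R RplusA Rplus_comm Rplus_0_l Rplus_opp_l.

Fact RmultA : associative Rmult.
Proof. by move=> x y z; rewrite Rmult_assoc. Qed.

Fact R1_neq_0b : R1 != R0.
Proof. by apply/eqP/R1_neq_R0. Qed.

HB.instance Definition _ :=
  GRing.Zmodule_isNzRing.Build R RmultA Rmult_1_l Rmult_1_r
    Rmult_plus_distr_r Rmult_plus_distr_l R1_neq_0b.

HB.instance Definition _ :=
  GRing.PzRing_hasCommutativeMul.Build R Rmult_comm.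

Section FormalPowerSeries.
Variable A : comNzRingType.

(** A formal power series over [A] is its sequence of coefficients. *)
Definition fps : Type := nat -> A.

Definition fps_one : fps := fun n => (n == 0%N)%:R.

Definition fps_mul (a b : fps) : fps :=
  fun n => \sum_(i < n.+1) a i * b (n - i)%N.

Definition fps_exp (a : fps) (l : nat) : fps := iter l (fps_mul a) fps_one.

End FormalPowerSeries.

(** Integer polynomials in countably many variables, the variable of index [m]
    standing for x_m; the index 0 is never used. *)
Notation polyN := {malg int[{cmonom nat}]}.

Definition polyN_var (m : nat) : polyN := << ucm m >>.

Definition generic_series : fps polyN :=
  fun m => if m == 0%N then 0 else polyN_var m.

(** Coefficient of [t ^ k] in the [l]-th power of [\sum_(m >= 1) x_m t ^ m]. *)
Definition ordinary_bell (k l : nat) : polyN := fps_exp generic_series l k.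

Definition monom_eval (x : nat -> R) (m : {cmonom nat}) : R :=
  \prod_(i <- finsupp m) x i ^+ m i.

(** Value of a polynomial under the substitution x_m := [x m]. *)
Definition polyN_eval (x : nat -> R) (p : polyN) : R :=
  mmap (intr : int -> R) (monom_eval x) p.

Lemma monom_evalEw (x : nat -> R) (d : {fset nat}) (m : {cmonom nat}) :
  {subset finsupp m <= d} -> monom_eval x m = \prod_(i <- d) x i ^+ m i.
Proof.
move=> /fsubsetP le_md; apply: big_fset_incl le_md _ => i _.
by rewrite -cmE_eq0 => /eqP ->; rewrite expr0.
Qed.

Lemma monom_eval_mmorphism (x : nat -> R) : mmorphism (monom_eval x).
Proof.
split=> [m1 m2|]; last by rewrite /monom_eval mdom1 big_seq_fset0.
have le1 : {subset finsupp m1 <= finsupp (mmul m1 m2)}.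
  by move=> i; rewrite mdomD in_fsetU => ->.
have le2 : {subset finsupp m2 <= finsupp (mmul m1 m2)}.
  by move=> i; rewrite mdomD in_fsetU => ->; rewrite orbT.
rewrite (monom_evalEw x le1) (monom_evalEw x le2) -big_split /=.
by apply: eq_bigr => i _; rewrite cmM exprD.
Qed.

HB.instance Definition _ (x : nat -> R) :=
  isMultiplicative.Build _ _ (monom_eval x) (monom_eval_mmorphism x).

Lemma polyN_eval_var (x : nat -> R) (m : nat) :
  polyN_eval x (polyN_var m) = x m.
Proof.
by rewrite /polyN_eval mmapU /= mul1r /monom_eval mdomU big_seq_fset1 cmUU.
Qed.

Lemma polyN_eval_bell (x : nat -> R) (k l : nat) :
  polyN_eval x (ordinary_bell k l) =
  fps_exp (fun m => if m == 0%N then 0 else x m) l k.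
Proof.
rewrite /ordinary_bell; elim: l k => [|l IHl] k /=.
  by rewrite /fps_one /polyN_eval rmorph_nat.
rewrite /fps_mul {1}/polyN_eval rmorph_sum; apply: eq_bigr => i _.
rewrite rmorphM; congr (_ * _); last exact: IHl.
rewrite /generic_series; case: eqP => _; first exact: mmap0.
exact: polyN_eval_var.
Qed.

Lemma fps_exp_lt (A : comNzRingType) (a : fps A) (k l : nat) :
  a 0%N = 0 -> (k < l)%N -> fps_exp a l k = 0.
Proof.
move=> a0; elim: l k => // l IHl k lt_kl; rewrite /= /fps_mul big1 // => i _.
have [->|i_gt0] := posnP i; first by rewrite a0 mul0r.
rewrite IHl ?mulr0 //; have := ltn_ord i; rewrite ltnS => le_ik.
by rewrite -ltnS (leq_trans _ lt_kl) // ltnS ltn_subrL i_gt0 (leq_trans i_gt0).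
Qed.

(** Only x_1, ..., x_(k - l + 1) occur in the polynomial of indices [k], [l]. *)
Lemma polyN_eval_bell_dep (x y : nat -> R) (k l : nat) :
  (forall m : nat, (0 < m <= k - l + 1)%N -> x m = y m) ->
  polyN_eval x (ordinary_bell k l) = polyN_eval y (ordinary_bell k l).
Proof.
rewrite !polyN_eval_bell; elim: l k => //= l IHl k eq_xy.
apply: eq_bigr => i _; have [->|i_gt0] := posnP i; first by rewrite !mul0r.
have le_ik : (i <= k)%N by rewrite -ltnS.
have [lt_kl|le_lk] := ltnP (k - i) l.
  by rewrite !fps_exp_lt ?mulr0.
have le_li : (l + i <= k)%N by rewrite addnC -leq_subRL.
congr (_ * _); first by apply: eq_xy; rewrite i_gt0 addn1; lia.
by apply: IHl => m /andP[m_gt0 le_m]; apply: eq_xy; rewrite m_gt0; lia.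
Qed.

(* Main.v *)
Require Import Defs.
From Stdlib Require Import Reals Lra.
From Coquelicot Require Import Coquelicot.
From mathcomp Require all_boot all_algebra.
Local Open Scope R_scope.

(** The chain rule [h' = (f' o g) * g'] and Leibniz' rule for functions have
    the same form as the rules for polynomials.  Say that a polynomial [p] is an
    [n]-jet of [u] at [a] when the derivatives of [u] at [a], up to order [n],
    are those of [p] at 0, and [u] is [n] times differentiable near [a].  Stating this by
    recursion on [n], through [Derive u] and the formal derivative of [p], turns
    the closure properties into short inductions: the jet of a product is the
    product of the jets ([has_jet_mul]), and if [p], [q] are jets of [g] at [a]
    and of [f] at [g a], then the polynomial composition of [q] with [p - p(0)]
    is a jet of [f o g] at [a] ([has_jet_comp]).  No rearrangement of double
    series is involved.

    An analytic function has its Taylor polynomials as jets, because power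
    series are differentiated term by term ([has_jet_analytic]), and conversely
    the coefficients of a jet are the differential transformation
    ([DT_has_jet]).  Hence the [k]-th coefficient of the transformation of
    [f o g] is the coefficient of degree [k] in the sum over [l <= k] of
    [F l * (p - p(0)) ^ l], and the coefficient of [(p - p(0)) ^ l] is the value
    of the Bell polynomial by its very definition as a power of a formal series
    ([coef_exp_fps]).  For [k >= 1] the term [l = 0] vanishes. *)

(* Inside the module the comparison and arithmetic notations on [nat] are the
   boolean ones; the theorem below the module uses those of Peano arithmetic. *)
Module Jets.
Import all_boot all_algebra.
Import GRing.Theory.
(* In this module the key R delimits [ring_scope]. *)
Delimit Scope R_scope with Re.
Local Open Scope ring_scope.
Set Implicit Arguments.
Unset Strict Implicit.
Unset Printing Implicit Defensive.

Lemma locally_imp2 (a : R) (P Q S : R -> Prop) :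
  locally a P -> locally a Q -> (forall t, P t -> Q t -> S t) -> locally a S.
Proof.
move=> locP locQ imp.
by apply: filter_imp (filter_and _ _ locP locQ) => t [Pt Qt]; apply: imp.
Qed.

(** The recursion goes through [Derive u] as a function, so that only first
    derivatives ever have to be computed, and it asks for differentiability on a
    neighbourhood, because the product and chain rules have to hold near [a]
    before their two sides can be differentiated again.  The
    polynomial is centred: its variable stands for [t - a], and coefficients of
    degree larger than [n] are arbitrary. *)
Fixpoint has_jet (n : nat) (u : R -> R) (a : R) (p : {poly R}) : Prop :=
  u a = p.[0] /\
  (if n is n'.+1
   then locally a (fun t => ex_derive u t) /\ has_jet n' (Derive u) a p^`()
   else True).

Lemma has_jet_value (n : nat) (u : R -> R) (a : R) (p : {poly R}) :
  has_jet n u a p -> u a = p.[0].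
Proof. by case: n => [|n] []. Qed.

Lemma has_jet_pred (n : nat) (u : R -> R) (a : R) (p : {poly R}) :
  has_jet n.+1 u a p -> has_jet n u a p.
Proof.
elim: n u p => [|n IHn] u p [u_a [du jet_du]]; first by split.
by split=> //; split=> //; apply: IHn.
Qed.

Lemma has_jet_ext (n : nat) (u v : R -> R) (a : R) (p : {poly R}) :
  locally a (fun t => u t = v t) -> has_jet n u a p -> has_jet n v a p.
Proof.
elim: n u v p => [|n IHn] u v p eq_uv [u_a].
  by split=> //; rewrite -u_a (locally_singleton _ _ eq_uv).
case=> [du jet_du]; split; first by rewrite -u_a (locally_singleton _ _ eq_uv).
have eq_uv2 := locally_locally _ _ eq_uv.
split.
  apply: locally_imp2 eq_uv2 du _ => t eq_t.
  exact: ex_derive_ext_loc.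
apply: IHn jet_du; apply: filter_imp eq_uv2 => t eq_t.
exact: Derive_ext_loc.
Qed.

Lemma has_jet_add (n : nat) (u v : R -> R) (a : R) (p q : {poly R}) :
  has_jet n u a p -> has_jet n v a q ->
  has_jet n (fun t => u t + v t) a (p + q).
Proof.
elim: n u v p q => [|n IHn] u v p q [u_a du] [v_a dv].
  by split; rewrite // hornerD u_a v_a.
case: du dv => [du jet_du] [dv jet_dv]; split; first by rewrite hornerD u_a v_a.
split.
  apply: locally_imp2 du dv _ => t dut dvt.
  exact: (ex_derive_plus (V := R_NormedModule) u v).
rewrite derivD; apply: has_jet_ext (IHn _ _ _ _ jet_du jet_dv).
by apply: locally_imp2 du dv _ => t dut dvt; rewrite Derive_plus.
Qed.

Lemma has_jet_mul (n : nat) (u v : R -> R) (a : R) (p q : {poly R}) :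
  has_jet n u a p -> has_jet n v a q ->
  has_jet n (fun t => u t * v t) a (p * q).
Proof.
elim: n u v p q => [|n IHn] u v p q jet_u jet_v.
  by split; rewrite // hornerM (has_jet_value jet_u) (has_jet_value jet_v).
have := has_jet_pred jet_v; have := has_jet_pred jet_u.
case: jet_u jet_v => [u_a [du jet_du]] [v_a [dv jet_dv]] jet_u jet_v.
split; first by rewrite hornerM u_a v_a.
split.
  by apply: locally_imp2 du dv _ => t dut dvt; apply: ex_derive_mult.
rewrite derivM.
have jet_D := has_jet_add (IHn _ _ _ _ jet_du jet_v) (IHn _ _ _ _ jet_u jet_dv).
apply: has_jet_ext jet_D.
by apply: locally_imp2 du dv _ => t dut dvt; rewrite Derive_mult.
Qed.

(** Subtracting the constant [p.[0]] makes the inner polynomial vanish at 0,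
    which is what a jet of [f] centred at [g a] requires; its derivative is
    still [p^`()], so that the two chain rules match. *)
Lemma has_jet_comp (n : nat) (f g : R -> R) (a : R) (q p : {poly R}) :
  has_jet n f (g a) q -> has_jet n g a p ->
  has_jet n (fun t => f (g t)) a (q \Po (p - (p.[0])%:P)).
Proof.
have value_comp (r : {poly R}) : (r \Po (p - (p.[0])%:P)).[0] = r.[0].
  by rewrite horner_comp hornerD hornerN hornerC subrr.
elim: n f q => [|n IHn] f q jet_f jet_g.
  by split; rewrite // value_comp -(has_jet_value jet_f).
have := has_jet_pred jet_g.
case: jet_f jet_g => [f_a [df jet_df]] [g_a [dg jet_dg]] jet_g.
split; first by rewrite value_comp f_a.
(* Continuity of [g] transports what holds for [f] near [g a] to points near
   [a]. *)
have cont_g : continuous g a.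
  by apply: ex_derive_continuous; apply: locally_singleton dg.
have df_g := cont_g _ df; split.
  by apply: locally_imp2 df_g dg _ => t dft dgt; apply: ex_derive_comp.
rewrite deriv_comp derivB derivC subr0.
apply: has_jet_ext (has_jet_mul (IHn _ _ jet_df jet_g) jet_dg).
apply: locally_imp2 df_g dg _ => t dft dgt.
by rewrite (Derive_comp f g) //; apply: mulrC.
Qed.

(** Compares the ring multiple with the real product in which [PS_derive]
    and [DT] express integer factors. *)
Lemma natmulE (x : R) (n : nat) : x *+ n = (x * INR n)%Re.
Proof.
elim: n => [|n IHn]; first exact/esym/Rmult_0_r.
by rewrite mulrSr IHn S_INR Rmult_plus_distr_l Rmult_1_r.
Qed.

(** Only the monomial of degree [k] contributes to the [k]-th derivative of [p]
    at 0, with the factor [k`!] by which [DT] divides. *)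
Lemma DT_has_jet (n : nat) (u : R -> R) (a : R) (p : {poly R}) (k : nat) :
  has_jet n u a p -> (k <= n)%N -> DT u a k = p`_k.
Proof.
have jet_Dn : forall u p, has_jet n u a p -> (k <= n)%N ->
    Derive_n u k a = p^`(k).[0].
  elim: k n {u p} => [|k IHk] [|n] u p // jet_u le_kn.
  - by rewrite derivn0 -(has_jet_value jet_u).
  - by rewrite derivn0 -(has_jet_value jet_u).
  case: jet_u => _ [_ jet_du].
  rewrite derivSn -(IHk n _ _ jet_du le_kn).
  by rewrite (Derive_n_comp u k 1) PeanoNat.Nat.add_1_r.
move=> jet_u le_kn; rewrite /DT (jet_Dn u p) //.
rewrite horner_coef0 coef_derivn addn0 ffactnn natmulE.
have -> : k`! = Factorial.fact k.
  by elim: k {le_kn jet_Dn} => //= k IHk; rewrite factS IHk.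
by field; apply: INR_fact_neq_0.
Qed.

(** Term-by-term differentiation needs points strictly inside the disk of
    convergence, while convergence on a ball of radius [e] allows the radius of
    convergence to be [e].  Halving the ball gives the strict inequality: the
    series converges at [a + e / 2], so its radius is at least [e / 2]. *)
Lemma locally_lt_CV_radius (c : nat -> R) (u : R -> R) (a : R) :
  locally a (fun t => is_pseries c (t - a)%Re (u t)) ->
  locally a (fun t => Rbar_lt (Rabs (t - a)%Re) (CV_radius c)).
Proof.
move=> [e ser_u].
have e2_gt0 : (0 < e / 2)%Re by case: e {ser_u} => e e_gt0 /=; lra.
exists (mkposreal _ e2_gt0) => t ball_t.
have abs_t : (Rabs (t - a) < e / 2)%Re by exact: ball_t.
apply: (Rbar_lt_le_trans (Rbar.Finite (Rabs (t - a)%Re))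
  (Rbar.Finite (e / 2)%Re) (CV_radius c) abs_t).
apply: Rbar_not_lt_le => radius_lt.
have b_ser : is_pseries c (a + e / 2 - a)%Re (u (a + e / 2)%Re).
  apply: ser_u; rewrite /ball /= /AbsRing_ball /abs /minus /plus /opp /=.
  have -> : (a + e / 2 + - a = e / 2)%Re by ring.
  by rewrite Rabs_pos_eq; lra.
have shift : (a + e / 2 - a = e / 2)%Re by ring.
rewrite shift in b_ser.
apply: (CV_disk_outside c (e / 2)%Re).
  by rewrite Rabs_pos_eq //; lra.
apply: ex_series_lim_0; exists (u (a + e / 2)%Re).
exact/is_pseries_R.
Qed.

Lemma has_jet_pseries (n : nat) (c : nat -> R) (u : R -> R) (a : R)
    (p : {poly R}) :
  locally a (fun t => is_pseries c (t - a)%Re (u t)) ->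
  (forall k, (k <= n)%N -> p`_k = c k) -> has_jet n u a p.
Proof.
have value_ser (c' : nat -> R) (u' : R -> R) :
    locally a (fun t => is_pseries c' (t - a)%Re (u' t)) -> u' a = c' 0%N.
  move/locally_singleton; rewrite Rminus_diag.
  by move/is_pseries_unique <-; rewrite PSeries_0.
elim: n c u p => [|n IHn] c u p ser_u eq_pc;
  split; rewrite ?horner_coef0 ?eq_pc ?(value_ser c u) //.
have du : locally a (fun t =>
    is_derive u t (PSeries (PS_derive c) (t - a)%Re)).
  have ser_u2 := locally_locally _ _ ser_u.
  apply: locally_imp2 ser_u2 (locally_lt_CV_radius ser_u) _.
  move=> t ser_t lt_t.
  apply: (is_derive_ext_loc (fun s => PSeries c (s - a)%Re)).
    by apply: filter_imp ser_t => s /is_pseries_unique.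
  (* The factor 1 is the derivative of the inner function [s - a]. *)
  have -> : PSeries (PS_derive c) (t - a)%Re =
      scal 1%Re (PSeries (PS_derive c) (t - a)%Re).
    by rewrite /scal /= /mult /= Rmult_1_l.
  apply: (is_derive_comp (PSeries c) (fun s => s - a)%Re).
    exact: is_derive_PSeries.
  by auto_derive.
split; first by apply: filter_imp du => t dut; eexists; exact: dut.
apply: (IHn (PS_derive c)).
  apply: locally_imp2 du (locally_lt_CV_radius ser_u) _.
  move=> t /is_derive_unique -> lt_t.
  by apply: PSeries_correct; apply: ex_pseries_derive.
by move=> k le_kn; rewrite coef_deriv eq_pc // natmulE Rmult_comm.
Qed.

(** The coefficients of the series representing [u] first give a jet, and this
    jet identifies them with [DT u a]. *)
Lemma has_jet_analytic (n : nat) (u : R -> R) (a : R) :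
  analytic_at u a -> has_jet n u a (\poly_(k < n.+1) DT u a k).
Proof.
case=> c ser_u.
have jet_c : has_jet n u a (\poly_(k < n.+1) c k).
  by apply: has_jet_pseries ser_u _ => k le_kn; rewrite coef_poly ltnS le_kn.
apply: has_jet_pseries ser_u _ => k le_kn; rewrite coef_poly ltnS le_kn.
by rewrite (DT_has_jet jet_c le_kn) coef_poly ltnS le_kn.
Qed.

(** The coefficient of degree [k] of a product involves only coefficients of
    degree at most [k], and polynomials multiply by the same convolution as
    formal power series; so truncation at degree [n] is harmless. *)
Lemma coef_exp_fps (A : comNzRingType) (a : fps A) (p : {poly A}) (n l k : nat) :
  (forall i, (i <= n)%N -> p`_i = a i) -> (k <= n)%N ->
  (p ^+ l)`_k = fps_exp a l k.
Proof.
move=> eq_pa; elim: l k => [|l IHl] k le_kn; first by rewrite expr0 coef1.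
rewrite exprS coefM /=; apply: eq_bigr => i _.
have le_ik : (i <= k)%N by rewrite -ltnS.
rewrite eq_pa ?(leq_trans le_ik) // IHl //.
by rewrite (leq_trans (leq_subr _ _)).
Qed.

Lemma sum_n_mE (F : nat -> R) (m n : nat) :
  sum_n_m F m n = \sum_(m <= l < n.+1) F l.
Proof.
have [lt_nm|le_mn] := ltnP n m.
  rewrite big_geq // sum_n_m_zero //; exact/ltP.
elim: n le_mn => [|n IHn] le_mn.
  by move: le_mn; rewrite leqn0 => /eqP ->; rewrite sum_n_n big_nat1.
move: le_mn; rewrite leq_eqVlt => /predU1P[->|lt_mn].
  by rewrite sum_n_n big_nat1.
have le_mSn := ltnW lt_mn.
by rewrite big_nat_recr //= -IHn // sum_n_Sm //; apply/leP.
Qed.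

(** Truncating both Taylor series at degree [k] gives jets of order [k], which
    suffice for the coefficient of degree [k]. *)
Lemma DT_comp (f g : R -> R) (a : R) (k : nat) :
  analytic_at g a -> analytic_at f (g a) ->
  DT (fun t => f (g t)) a k =
  \sum_(l < k.+1) DT f (g a) l * polyN_eval (DT g a) (ordinary_bell k l).
Proof.
move=> an_g an_f; set p : {poly R} := \poly_(i < k.+1) DT g a i.
have jet_h := has_jet_comp (has_jet_analytic k an_f) (has_jet_analytic k an_g).
rewrite (DT_has_jet jet_h (leqnn k)) -/p.
rewrite [X in X \Po _]poly_def raddf_sum coef_sum.
apply: eq_bigr => l _; rewrite /= comp_polyZ comp_Xn_poly coefZ polyN_eval_bell.
congr (_ * _); apply: (@coef_exp_fps _ _ _ k) => // i le_ik.
rewrite coefB coefC horner_coef0.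
by case: eqP => [->|_]; rewrite ?subrr // subr0 coef_poly ltnS le_ik.
Qed.

(** The power of exponent 0 is 1, whose coefficients of positive degree are
    zero; so the sum may start at 1. *)
Lemma DT_comp_pos (f g : R -> R) (a : R) (k : nat) :
  analytic_at g a -> analytic_at f (g a) -> (1 <= k)%coq_nat ->
  DT (fun t => f (g t)) a k =
  sum_n_m (fun l => DT f (g a) l * polyN_eval (DT g a) (ordinary_bell k l)) 1 k.
Proof.
move=> an_g an_f /leP k_gt0; rewrite DT_comp // sum_n_mE.
rewrite -(big_mkord xpredT
  (fun l => DT f (g a) l * polyN_eval (DT g a) (ordinary_bell k l))).
rewrite big_ltn // polyN_eval_bell /= /fps_one.
by rewrite eqn0Ngt k_gt0 mulr0 add0r.
Qed.

End Jets.

Theorem theorem2 (t0 : R) (f g : R -> R) :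
  analytic_near g t0 ->
  analytic_near f (g t0) ->
  let h := fun t : R => f (g t) in
  let G := DT g t0 in
  let F := DT f (g t0) in
  let H := DT h t0 in
  H 0%nat = F 0%nat /\
  (forall k : nat, (1 <= k)%nat ->
     H k = sum_n_m (fun l : nat => F l * polyN_eval G (ordinary_bell k l)) 1 k).
Proof.
intros an_g an_f; split.
  reflexivity.
intros k k_gt0; apply Jets.DT_comp_pos; trivial.
  exact (locally_singleton _ _ an_g).
exact (locally_singleton _ _ an_f).
Qed.
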